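(* Let $n\ge2$. For every real correlation matrix $M\in\mathbb{R}^{n\times n}$ there exists an inverse eigenvector $\alpha\in\mathcal{I}(M)$ satisfying $|p(\alpha)|\le 1$, where $p(x)=\prod_{j=1}^n x_j$.
   Context: A real correlation matrix is a real symmetric positive semidefinite matrix all of whose diagonal entries equal $1$. For an $n\times n$ matrix $M$, the set of inverse eigenvectors is $\mathcal{I}(M)=\{\alpha\in\mathbb{C}^n:\ \alpha_k(M\alpha)_k=1\text{ for every }k\in\{1,\dots,n\}\}$; for a real symmetric positive semidefinite $M$ it is contained in $\mathbb{R}^n$. *)

(* Defs.v *)
From HB Require Import structures.
From mathcomp Require Import all_boot all_order all_algebra.
From mathcomp Require Import classical_sets reals.
From mathcomp.real_closed Require Import complex.

Set Implicit Arguments.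
Unset Strict Implicit.
Unset Printing Implicit Defensive.

Import Order.TTheory GRing.Theory Num.Theory.
Local Open Scope ring_scope.
Local Open Scope classical_set_scope.

Definition psdmx (R : realType) (n : nat) (M : 'M[R]_n) : Prop :=
  M^T = M /\ forall x : 'cV[R]_n, 0 <= (x^T *m M *m x) 0 0.

Definition correlation_matrix (R : realType) (n : nat) (M : 'M[R]_n) : Prop :=
  psdmx M /\ forall i : 'I_n, M i i = 1.

Definition inverse_eigenvectors (R : realType) (n : nat) (M : 'M[R[i]]_n) :
    set 'cV[R[i]]_n :=
  [set alpha : 'cV[R[i]]_n | forall k : 'I_n, alpha k 0 * (M *m alpha) k 0 = 1].

Definition coord_prod (R : realType) (n : nat) (x : 'cV[R[i]]_n) : R[i] :=
  \prod_(j < n) x j 0.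

(* Main.v *)
Require Import Defs.
From HB Require Import structures.
From mathcomp Require Import all_boot all_order all_algebra.
From mathcomp Require Import all_fingroup.
From mathcomp Require Import classical_sets reals boolp.
From mathcomp Require Import topology normedtype derive.
From mathcomp Require Import ring lra.
From mathcomp.real_closed Require Import complex.

Set Implicit Arguments.
Unset Strict Implicit.
Unset Printing Implicit Defensive.

Import Order.TTheory GRing.Theory Num.Theory.
Import numFieldNormedType.Exports.
Local Open Scope ring_scope.

(** Call a row [x] with [x_k (x M)_k = 1] for every [k] a solution for [M].
    If [M] has unit diagonal, every solution with [sum_k x_k^2 <= n] also has
    [|prod_k x_k| <= 1], by the inequality between arithmetic and geometric
    means.  Such a short solution is found by averaging over all solutions.

    Suppose first that [M] is positive definite.  Then each of the [2^n] open
    orthants contains a solution ([inveig_orthant]), a critical point of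
    [(prod_k x_k) (n + 2 - x M x^T)].  For two solutions [x] and [y] put
    [K(x, y) = det (1 + M diag(x_k y_k))].  Three facts carry the proof.

    - Orthogonality: if [x <> y] then [K(x, y) = 0], because [x - y] lies in
      the kernel ([det_kernel_inveig]).
    - Positivity: [K(x, x) > 0], because [M] is positive semidefinite
      ([psd_det_gt0]).
    - Expansion: [K(x, y) = sum_S c_S x_S y_S], the sum being over the [2^n]
      sets [S] of indices, where [x_S] is the product of the [x_i] with
      [i] in [S] and [c_S] is the principal minor of [M] on [S]
      ([det_add1_diag]).

    So the matrix [(x_S)], with a row for each solution and a column for each
    [S], is square, and it is inverted by [(c_S x_S / K(x, x))].  A one-sided
    inverse of a square matrix is two-sided; multiplying in the other order
    gives [sum_x c_S x_S^2 / K(x, x) = 1] for every [S].  With the weights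
    [w_x = 1 / K(x, x)], the empty set yields [sum_x w_x = 1], and the
    singletons yield [sum_x w_x x_k^2 = 1] ([inveig_weights]).  The weighted
    mean of [sum_k x_k^2] is therefore exactly [n], and some solution does not
    exceed it ([inveig_small_norm]).

    A singular [M] is the limit of the positive definite matrices
    [(1 - e) M + e], whose short solutions stay in one compact ball
    ([inveig_small_norm_psd]). *)

(** * The kernel of two solutions *)

(** This is the principal minor of [M] on [S]: expanding along the unit rows
    leaves the submatrix with rows and columns in [S].  Replacing rows avoids
    reindexing the submatrix. *)
Definition rows_minor (F : comNzRingType) n (M : 'M[F]_n) (S : {set 'I_n}) : F :=
  \det (\matrix_(i, j) if i \in S then M i j else (i == j)%:R).

(** The determinant is linear in each row, and row [i] of [1 + diag(x) M] is
    the sum of a unit row and of [x_i] times row [i] of [M]. *)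
Lemma det_add1_diag (F : comNzRingType) n (x : 'rV[F]_n) (M : 'M[F]_n) :
  \det (1%:M + diag_mx x *m M) =
  \sum_(S : {set 'I_n}) rows_minor M S * \prod_(i in S) x 0 i.
Proof.
under [RHS]eq_bigr do rewrite /rows_minor /determinant mulr_suml.
rewrite exchange_big /=; apply: eq_bigr => s _.
under eq_bigr do rewrite mul_diag_mx !mxE addrC.
rewrite bigA_distr mulr_sumr; apply: eq_big => // S _.
rewrite -mulrA; congr (_ * _).
rewrite [X in _ * X]big_mkcond -big_split /=; apply: eq_bigr => i _.
by rewrite mxE; case: ifP; rewrite ?mulr1 // mulrC.
Qed.

Lemma rows_minor0 (F : comNzRingType) n (M : 'M[F]_n) : rows_minor M finset.set0 = 1.
Proof.
rewrite -[RHS](@det1 F n); congr (\det _).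
by apply/matrixP => i j; rewrite !mxE inE.
Qed.

Lemma rows_minor1 (F : comNzRingType) n (M : 'M[F]_n) k :
  rows_minor M [set k] = M k k.
Proof.
rewrite /rows_minor /determinant (bigD1 (1%g : 'S_n)) //=.
(* A permutation other than the identity moves an index other than [k], and
   picks a zero of the unit row there. *)
rewrite [X in _ + X]big1 ?addr0 => [|s sN1].
  rewrite odd_perm1 expr0 mul1r (bigD1 k) //= big1 ?mulr1 => [|i ik].
    by rewrite !mxE inE eqxx perm1.
  by rewrite !mxE inE (negPf ik) perm1 eqxx.
have [i ik si] : exists2 i, i != k & s i != i.
  have [i si] : exists i, s i != i.
    apply/existsP; apply: contraR sN1 => /existsPn sE; apply/eqP/permP => i.
    by rewrite perm1; apply/eqP; rewrite -[_ == _]negbK sE.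
  case: (eqVneq i k) si => [->|ik] sik; last by exists i.
  by exists (s k); last by rewrite (inj_eq perm_inj).
rewrite (bigD1 i) //= !mxE inE (negPf ik) eq_sym (negPf si).
by rewrite mul0r mulr0.
Qed.

(** Rows instead of columns, since the kernel criterion for determinants and
    the compactness theorems are about rows. *)
Definition row_inveig (F : comNzRingType) n (M : 'M[F]_n) (x : 'rV[F]_n) :=
  forall k, x 0 k * (x *m M) 0 k = 1.

(** The difference [v = x - y] is in the left kernel: coordinate [k] of
    [v M] is [1 / x_k - 1 / y_k], so multiplying it by [x_k y_k] gives [- v_k]. *)
Lemma det_kernel_inveig (F : fieldType) n (M : 'M[F]_n) (x y : 'rV[F]_n) :
  row_inveig M x -> row_inveig M y -> x != y ->
  \det (1%:M + M *m diag_mx (\row_k (x 0 k * y 0 k))) = 0.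
Proof.
move=> hx hy xy; apply/eqP/det0P; exists (x - y); first by rewrite subr_eq0.
apply/rowP => k; rewrite mulmxDr mulmx1 mulmxA mulmxBl mul_mx_diag !mxE.
have := hx k; have := hy k; rewrite !mxE.
set u := \sum_j _; set v := \sum_j _ => hu hv.
rewrite mulrBl (mulrA v) (mulrC v) hv mul1r (mulrCA u) (mulrC u) hu mulr1.
by rewrite addrA addrNK subrr.
Qed.

(** * Weights on the solutions *)

Section Psd.
Variables (R : realType) (n : nat) (M : 'M[R]_n).
Hypothesis psdM : forall x : 'rV[R]_n, 0 <= (x *m M *m x^T) 0 0.

(** If [v = - (v M) D] with [D = diag(d)], then [v M v^T >= 0] is also
    [- sum_k d_k (v M)_k^2 <= 0]; hence [(v M) D = 0] and [v = 0]. *)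
Lemma psd_det_neq0 (d : 'rV[R]_n) :
  (forall k, 0 <= d 0 k) -> \det (1%:M + M *m diag_mx d) != 0.
Proof.
move=> d0; apply/negP => /det0P [v vN0 /rowP hv].
have {}hv k : v 0 k = - ((v *m M) 0 k * d 0 k).
  have := hv k; rewrite mulmxDr mulmx1 mulmxA mul_mx_diag !mxE => /eqP.
  by rewrite addr_eq0 => /eqP.
have dge0 k : 0 <= d 0 k * (v *m M) 0 k ^+ 2 by rewrite mulr_ge0 ?sqr_ge0.
have sum0 : \sum_k d 0 k * (v *m M) 0 k ^+ 2 = 0.
  apply/eqP; rewrite eq_le sumr_ge0 // andbT -oppr_ge0.
  have := psdM v; rewrite mxE => /le_trans; apply; rewrite -sumrN.
  apply: ler_sum => k _.
  by rewrite [_^T _ _]mxE hv mulrN mulrA -expr2 mulrC.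
case/negP: vN0; apply/eqP/rowP => k; rewrite [RHS]mxE hv.
have /eqP := @psumr_eq0P _ _ _ _ (fun k _ => dge0 k) sum0 k isT.
by rewrite mulf_eq0 sqrf_eq0 => /orP[] /eqP ->; rewrite ?mulr0 ?mul0r oppr0.
Qed.

(** The polynomial [det (1 + s M D)] in [s] is 1 at 0 and has no root with
    [s >= 0], so it cannot change sign before [s = 1]. *)
Lemma psd_det_gt0 (d : 'rV[R]_n) :
  (forall k, 0 <= d 0 k) -> 0 < \det (1%:M + M *m diag_mx d).
Proof.
move=> d0.
pose p : {poly R} := \det (1%:M + map_mx polyC M *m diag_mx (\row_k ((d 0 k)%:P * 'X))).
have pE s : p.[s] = \det (1%:M + M *m diag_mx (s *: d)).
  rewrite -[p.[s]]/(horner_eval s p) /p -det_map_mx; congr (\det _).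
  apply/matrixP => i j; rewrite !mul_mx_diag !mxE rmorphD rmorphM rmorph_nat /=.
  by rewrite /horner_eval hornerM !hornerC hornerX (mulrC s).
rewrite ltNge; apply/negP => det_le0.
have p0 : p.[0] = 1 by rewrite pE scale0r linear0 mulmx0 addr0 det1.
have p1 : p.[1] <= 0 by rewrite pE scale1r.
have [||s /andP[s0 _] /rootP] := @poly_ivt R (- p) 0 1.
- exact: ler01.
- by rewrite !hornerN p0 lerN10 oppr_ge0.
rewrite hornerN => /eqP; rewrite oppr_eq0 pE => /eqP ps0.
have sd0 k : 0 <= (s *: d) 0 k by rewrite mxE mulr_ge0.
by have := psd_det_neq0 sd0; rewrite ps0 eqxx.
Qed.

Hypothesis symM : M^T = M.

(** The [2^n] solutions are indexed by sets of indices, as the monomials are,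
    so that the matrix of values of the monomials is square. *)
Lemma inveig_weights (a : {set 'I_n} -> 'rV[R]_n) :
  injective a -> (forall T, row_inveig M (a T)) ->
  exists w : {set 'I_n} -> R, [/\ forall T, 0 < w T, \sum_T w T = 1
    & forall k, M k k * \sum_T w T * a T 0 k ^+ 2 = 1].
Proof.
move=> a_inj ha.
pose K S T := \det (1%:M + M *m diag_mx (\row_k (a S 0 k * a T 0 k))).
have KE S T : K S T = \sum_(U : {set 'I_n})
    rows_minor M U * (\prod_(i in U) a S 0 i) * \prod_(i in U) a T 0 i.
  rewrite /K -det_tr linearD /= tr_scalar_mx trmx_mul tr_diag_mx symM.
  rewrite det_add1_diag; apply: eq_bigr => U _.
  by rewrite -mulrA -big_split /=; under eq_bigr do rewrite mxE.
have KN S T : S != T -> K S T = 0.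
  by move=> ST; apply: det_kernel_inveig; rewrite ?(inj_eq a_inj).
have Kgt0 T : 0 < K T T.
  by apply: psd_det_gt0 => k; rewrite mxE -expr2 sqr_ge0.
pose N := #|{set 'I_n}|.
pose mon (T U : {set 'I_n}) := \prod_(i in U) a T 0 i.
pose w T := (K T T)^-1.
pose E : 'M[R]_N := \matrix_(t, u) mon (enum_val t) (enum_val u).
pose L : 'M[R]_N := \matrix_(u, t)
  (rows_minor M (enum_val u) * mon (enum_val t) (enum_val u) * w (enum_val t)).
have EL : E *m L = 1%:M.
  apply/matrixP => s t; rewrite !mxE.
  transitivity (K (enum_val t) (enum_val s) * w (enum_val t)).
    rewrite KE mulr_suml [RHS](reindex_onto enum_val enum_rank) /=; last first.
      by move=> U _; rewrite enum_rankK.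
    apply: eq_big => u; first by rewrite enum_valK eqxx.
    by move=> _; rewrite !mxE mulrC mulrAC.
  have [->|st] := eqVneq s t; first by rewrite mulfV ?gt_eqF.
  by rewrite KN ?mul0r // (inj_eq enum_val_inj) eq_sym.
have orth U : \sum_T rows_minor M U * mon T U * w T * mon T U = 1.
  have /matrixP/(_ (enum_rank U) (enum_rank U)) := mulmx1C EL.
  rewrite !mxE eqxx => orthU; transitivity (true%:R : R) => //; rewrite -orthU.
  rewrite (reindex_onto enum_val enum_rank) /=; last first.
    by move=> T _; rewrite enum_rankK.
  apply: eq_big => t; first by rewrite enum_valK eqxx.
  by move=> _; rewrite !mxE enum_rankK.
exists w; split => [T||k]; first by rewrite invr_gt0.
  rewrite -[RHS](orth finset.set0); apply: eq_bigr => T _.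
  by rewrite /mon !big_set0 rows_minor0 !mulr1 mul1r.
rewrite -[RHS](orth [set k]) mulr_sumr; apply: eq_bigr => T _.
by rewrite /mon !big_set1 rows_minor1 expr2 -!mulrA; congr (_ * _); rewrite mulrCA.
Qed.

(** The weights have total mass 1 and give each [x_k^2] the mean 1, so the mean
    of [sum_k x_k^2] is [n]. *)
Lemma inveig_small_norm (a : {set 'I_n} -> 'rV[R]_n) :
  (forall k, M k k = 1) -> injective a -> (forall T, row_inveig M (a T)) ->
  exists T, \sum_k a T 0 k ^+ 2 <= n%:R.
Proof.
move=> M1 a_inj ha; have [w [w0 sw swa]] := inveig_weights a_inj ha.
apply/existsP; apply: contraT => /existsPn big.
have : 0 < \sum_T w T * (\sum_k a T 0 k ^+ 2 - n%:R).
  rewrite (bigD1 finset.set0) //= ltr_wpDr ?sumr_ge0 // => [T _|].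
    by rewrite mulr_ge0 ?subr_ge0 // ltW // ltNge big.
  by rewrite mulr_gt0 ?subr_gt0 // ltNge big.
under eq_bigr do rewrite mulrBr mulr_sumr.
rewrite sumrB -mulr_suml sw mul1r exchange_big /=.
rewrite (eq_bigr (fun=> 1)) => [|k _]; last by rewrite -(swa k) M1 mul1r.
by rewrite sumr_const card_ord subrr ltxx.
Qed.
End Psd.

(** * Continuity of the functions to be optimized *)

Section Continuity.
Variables (R : realType) (n : nat).
Implicit Types f g : 'rV[R]_n -> R.

Lemma coord_cont k : continuous (fun x : 'rV[R]_n => x 0 k).
Proof. exact: coord_continuous. Qed.

Lemma mul_cont f g :
  continuous f -> continuous g -> continuous (fun x => f x * g x).
Proof. by move=> fc gc x; apply: continuousM; [exact: fc|exact: gc]. Qed.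

Lemma sub_cont f g :
  continuous f -> continuous g -> continuous (fun x => f x - g x).
Proof. by move=> fc gc x; apply: continuousB; [exact: fc|exact: gc]. Qed.

Lemma sum_cont (I : finType) (F : I -> 'rV[R]_n -> R) :
  (forall i, continuous (F i)) -> continuous (fun x => \sum_i F i x).
Proof.
by move=> Fc; apply: continuous_big => [|i _]; [exact: add_continuous|exact: Fc].
Qed.

Lemma prod_cont (I : finType) (F : I -> 'rV[R]_n -> R) :
  (forall i, continuous (F i)) -> continuous (fun x => \prod_i F i x).
Proof.
by move=> Fc; apply: continuous_big => [|i _]; [exact: mul_continuous|exact: Fc].
Qed.

Lemma sqnorm_cont : continuous (fun x : 'rV[R]_n => \sum_k x 0 k ^+ 2).
Proof. by apply: sum_cont => k; apply: mul_cont; exact: coord_cont. Qed.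

Lemma mulmx_coord_cont (M : 'M[R]_n) k :
  continuous (fun x : 'rV[R]_n => (x *m M) 0 k).
Proof.
under eq_fun do rewrite mxE.
by apply: sum_cont => j; apply: mul_cont; [exact: coord_cont|exact: cst_continuous].
Qed.

Lemma qform_cont (M : 'M[R]_n) :
  continuous (fun x : 'rV[R]_n => (x *m M *m x^T) 0 0).
Proof.
under eq_fun do rewrite mxE.
apply: sum_cont => j; apply: mul_cont; first exact: mulmx_coord_cont.
by under eq_fun do rewrite mxE; exact: coord_cont.
Qed.

End Continuity.

(** * A solution in each orthant *)

Lemma mx11_addE (R : nmodType) (A B : 'M[R]_1) : (A + B) 0 0 = A 0 0 + B 0 0.
Proof. by rewrite mxE. Qed.

Lemma mx11_scaleE (R : pzRingType) c (A : 'M[R]_1) : (c *: A) 0 0 = c * A 0 0.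
Proof. by rewrite mxE. Qed.

Lemma qform_shift (R : realType) n (M : 'M[R]_n) (x : 'rV[R]_n) k t :
  M^T = M ->
  ((x + t *: delta_mx 0 k) *m M *m (x + t *: delta_mx 0 k)^T) 0 0 =
  (x *m M *m x^T) 0 0 + t * (2 * (x *m M) 0 k + t * M k k).
Proof.
move=> symM; set e : 'rV_n := delta_mx 0 k.
have eT (v : 'rV_n) : (v *m e^T) 0 0 = v 0 k.
  by rewrite trmx_delta -colE mxE.
have swap : (e *m M *m x^T) 0 0 = (x *m M *m e^T) 0 0.
  have -> : e *m M *m x^T = (x *m M *m e^T)^T.
    by rewrite !trmx_mul trmxK symM mulmxA.
  by rewrite mxE.
have eMe : (e *m M *m e^T) 0 0 = M k k by rewrite eT -rowE mxE.
rewrite linearD linearZ /= !(mulmxDl, mulmxDr) -!(scalemxAl, scalemxAr).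
rewrite !(mx11_addE, mx11_scaleE) swap eMe eT; ring.
Qed.

(** The first order condition at a maximum along a coordinate axis, on which
    the function maximized in [inveig_pos] is a cubic. *)
Lemma eq0_of_local_max (R : realFieldType) (A B C r : R) : 0 < r ->
  (forall t, `|t| <= r -> t * (A + t * (B + t * C)) <= 0) -> A = 0.
Proof.
move=> r0 h; apply/eqP/negPn/negP => A0.
(* For [|t| <= r] the factor of [t^2] is less than [D] in absolute value, so
   a step of length [e < |A| / D] in the direction of [A] increases the cubic. *)
pose D := `|B| + r * `|C| + 1.
have D0 : 0 < D by rewrite /D; have := normr_ge0 B; have := normr_ge0 C; nra.
have nA : 0 < `|A| by rewrite normr_gt0.
pose e := Num.min r (`|A| / (2 * D)).
have e0 : 0 < e by rewrite lt_min r0 divr_gt0 // mulr_gt0.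
have er : e <= r by rewrite ge_min lexx.
have eA : e * D < `|A|.
  have : e * (2 * D) <= `|A| by rewrite -ler_pdivlMr ?mulr_gt0 // ge_min lexx orbT.
  nra.
have sgA : Num.sg A * A = `|A| by rewrite [RHS]normrEsg.
have [t nt tA] : exists2 t, `|t| = e & t * A = `|A| * e.
  exists (Num.sg A * e); first by rewrite normrM normr_sg A0 mul1r gtr0_norm.
  by rewrite mulrAC sgA.
have := h t; rewrite nt => /(_ er).
rewrite mulrDr tA leNgt => /negP; apply.
have : - (t * (t * (B + t * C))) < `|A| * e.
  apply: le_lt_trans (ler_norm _) _; rewrite normrN !normrM nt mulrCA mulrC.
  rewrite ltr_pM2r // mulrC.
  apply: le_lt_trans eA; rewrite mulrC ler_pM2l //.
  apply: le_trans (ler_normD _ _) _; rewrite normrM nt /D -addrA lerD2l.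
  by rewrite ler_wpDr // ler_wpM2r.
lra.
Qed.

(** Maximize [H(x) = (prod_k x_k) (N - q(x))] over the closed positive orthant,
    with [q] the quadratic form of [M].  At the maximum [H > 0], so [x] is
    interior, and the partial derivatives give [2 x_k (x M)_k = N - q(x)] for
    all [k].  Summing over [k], [2 q(x) = n (N - q(x))], and [N = n + 2] is the
    value for which this forces [q(x) = n] and hence [x_k (x M)_k = 1]. *)
Lemma inveig_pos (R : realType) (n : nat) (M : 'M[R]_n) (c : R) :
  M^T = M -> 0 < c ->
  (forall x : 'rV[R]_n, c * \sum_k x 0 k ^+ 2 <= (x *m M *m x^T) 0 0) ->
  exists2 x : 'rV[R]_n, forall k, 0 < x 0 k & row_inveig M x.
Proof.
move=> symM c0 coercive.
pose q (x : 'rV[R]_n) := (x *m M *m x^T) 0 0.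
pose H (x : 'rV[R]_n) := (\prod_k x 0 k) * (n.+2%:R - q x).
have q_ge0 x : 0 <= q x.
  apply: le_trans (coercive x); apply: mulr_ge0; first exact: ltW.
  by apply: sumr_ge0 => k _; rewrite sqr_ge0.
have Hcont : continuous H.
  apply: mul_cont; first by apply: prod_cont => k; exact: coord_cont.
  by apply: sub_cont; [exact: cst_continuous|exact: qform_cont].
(* In the orthant but outside the box [0, B]^n coercivity makes [N - q]
   nonpositive, so the maximum over the box is a maximum over the orthant. *)
pose B : R := n.+2%:R / c + 1.
have B1 : 1 <= B by rewrite lerDr divr_ge0 // ltW.
have cB : n.+2%:R <= c * B ^+ 2.
  have : n.+2%:R <= c * B by rewrite /B mulrDr mulrCA divff ?gt_eqF // mulr1 lerDl mulr1 ltW.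
  move=> /le_trans; apply; rewrite expr2 ler_pM2l // ler_peMr //; lra.
pose box := [set x : 'rV[R]_n | forall k, `[0, B]%classic (x ord0 k)]%classic.
have box_compact : compact box.
  apply: (@rV_compact _ _ (fun=> `[0, B]%classic)) => _; exact: segment_compact.
have box0 : box 0 by move=> k /=; rewrite mxE in_itv /= lexx; lra.
have [x xbox xmax] := @EVT_max_rV R n H box (ex_intro _ 0 box0) box_compact
  (continuous_subspaceT Hcont).
have {}xbox k : 0 <= x 0 k by have := set_mem xbox => /(_ k) /=; rewrite in_itv => /andP[].
have Hx : 0 < H x.
  (* A small multiple of the all-ones vector, with [q] less than 1 there. *)
  pose s := q (const_mx 1); pose t := (1 + s)^-1.
  have s1 : 0 < 1 + s by rewrite ltr_pwDl ?q_ge0.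
  have t0 : 0 < t by rewrite invr_gt0.
  have t1 : t <= 1 by rewrite invf_le1 // lerDl q_ge0.
  have ts : t * (1 + s) = 1 by rewrite mulVf ?gt_eqF.
  apply: (@lt_le_trans _ _ (H (t *: const_mx 1))); last first.
    apply/xmax/mem_set => k /=; rewrite !mxE mulr1 in_itv /= ltW //=.
    exact: le_trans t1 B1.
  rewrite mulr_gt0 ?prodr_gt0 // => [k _|]; first by rewrite !mxE mulr1.
  have -> : q (t *: const_mx 1) = t * (t * s).
    by rewrite /q linearZ /= -!(scalemxAl, scalemxAr) !mx11_scaleE.
  have n1 : 2 <= n.+2%:R :> R by rewrite ler_nat.
  rewrite subr_gt0; apply: lt_le_trans n1; nra.
have xpos_max (z : 'rV[R]_n) : (forall k, 0 <= z 0 k) -> H z <= H x.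
  move=> z0; have [zB|] := boolP [forall k, z 0 k <= B].
    by apply/xmax/mem_set => k /=; rewrite in_itv /= z0 (forallP zB).
  rewrite negb_forall => /existsP[k]; rewrite -ltNge => zk.
  apply: le_trans (ltW Hx).
  rewrite /H mulr_ge0_le0 ?prodr_ge0 // subr_le0.
  apply: le_trans (coercive z); apply: (le_trans cB); rewrite ler_pM2l //.
  rewrite (bigD1 k) //= ler_wpDr ?sumr_ge0 // => [i _|]; first by rewrite sqr_ge0.
  by rewrite lerXn2r ?nnegrE // ltW //; lra.
have xgt0 k : 0 < x 0 k.
  rewrite lt_neqAle xbox andbT eq_sym; apply: contraTneq Hx => xk0.
  by rewrite /H (bigD1 k) //= xk0 !mul0r ltxx.
have crit k : (n.+2%:R - q x) - 2 * x 0 k * (x *m M) 0 k = 0.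
  apply: (@eq0_of_local_max _ _ (- 2 * (x *m M) 0 k - x 0 k * M k k) (- M k k)
    _ (xgt0 k)) => t tx.
  pose z := x + t *: delta_mx 0 k.
  have zk : z 0 k = x 0 k + t by rewrite !mxE !eqxx mulr1.
  have zi i : i != k -> z 0 i = x 0 i.
    by move=> ik; rewrite !mxE (negPf ik) andbF mulr0 addr0.
  have /xpos_max : forall i, 0 <= z 0 i.
    move=> i; have [->|/zi -> //] := eqVneq i k.
    by rewrite zk -lerBlDl sub0r; case/ler_normlP: tx => tx _; rewrite lerNl.
  rewrite /H (bigD1 k) //= (eq_bigr (x 0)); last by move=> i /zi.
  rewrite [in X in _ <= X](bigD1 k) //= zk /q qform_shift // -/(q x).
  set P := \prod_(_ < _ | _) _; set y := (x *m M) 0 k.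
  have P0 : 0 < P by apply: prodr_gt0.
  rewrite -!mulrA ![_ * (P * _)]mulrCA ler_pM2l // => le_x.
  nra.
have qE : 2 * q x = n%:R * (n.+2%:R - q x).
  rewrite {1}/q mxE mulr_sumr -[n in n%:R * _]card_ord mulr_natl -sumr_const.
  apply: eq_bigr => k _; rewrite [_^T _ _]mxE.
  by apply/eqP; rewrite eq_sym -subr_eq0 -[X in _ == X](crit k) -mulrA (mulrC (x 0 k)).
have q_n : q x = n%:R.
  have n2 : (n.+2%:R : R) = n%:R + 2 by rewrite -addn2 natrD.
  have n0 : 0 <= n%:R :> R by [].
  rewrite n2 in qE; apply: (@mulfI _ (n%:R + 2)); first by rewrite gt_eqF //; lra.
  nra.
exists x => // k; have := crit k; rewrite q_n -addn2 natrD; nra.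
Qed.

(** Conjugating [M] by the diagonal matrix of the signs of the orthant of [T]
    moves that orthant to the positive one. *)
Lemma inveig_orthant (R : realType) (n : nat) (M : 'M[R]_n) (c : R) (T : {set 'I_n}) :
  M^T = M -> 0 < c ->
  (forall x : 'rV[R]_n, c * \sum_k x 0 k ^+ 2 <= (x *m M *m x^T) 0 0) ->
  exists2 x : 'rV[R]_n, row_inveig M x & forall k, (0 < x 0 k) = (k \in T).
Proof.
move=> symM c0 coercive.
pose s (k : 'I_n) : R := if k \in T then 1 else -1.
have s2 k : s k * s k = 1 by rewrite /s; case: ifP; rewrite ?mulrNN mulr1.
pose D := diag_mx (\row_k s k).
have DE (x : 'rV_n) k : (x *m D) 0 k = x 0 k * s k by rewrite mul_mx_diag !mxE.
have symD : D^T = D by rewrite tr_diag_mx.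
have [||x xgt0 xinv] := @inveig_pos R n (D *m M *m D) c _ c0.
- by rewrite !trmx_mul symD symM mulmxA.
- move=> x; have := coercive (x *m D).
  rewrite trmx_mul symD !mulmxA; apply: le_trans.
  rewrite ler_pM2l //; apply: ler_sum => k _.
  by rewrite DE exprMn [s k ^+ 2]s2 mulr1.
exists (x *m D) => k.
  by have := xinv k; rewrite !mulmxA !DE mulrA mulrAC.
rewrite DE /s; case: ifP => _; first by rewrite mulr1 xgt0.
by rewrite mulrN1 oppr_gt0 ltNge ltW.
Qed.

(** * Short solutions *)

Lemma inveig_small_norm_coercive (R : realType) (n : nat) (M : 'M[R]_n) (c : R) :
  M^T = M -> (forall k, M k k = 1) -> 0 < c ->
  (forall x : 'rV[R]_n, c * \sum_k x 0 k ^+ 2 <= (x *m M *m x^T) 0 0) ->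
  exists2 x : 'rV[R]_n, row_inveig M x & \sum_k x 0 k ^+ 2 <= n%:R.
Proof.
move=> symM M1 c0 coercive.
have psdM (x : 'rV[R]_n) : 0 <= (x *m M *m x^T) 0 0.
  apply: le_trans (coercive x); apply: mulr_ge0; first exact: ltW.
  by apply: sumr_ge0 => k _; rewrite sqr_ge0.
have /choice[a ha] : forall T : {set 'I_n}, exists x : 'rV[R]_n,
    row_inveig M x /\ forall k, (0 < x 0 k) = (k \in T).
  by move=> T; have [x ? ?] := inveig_orthant T symM c0 coercive; exists x.
have a_inj : injective a.
  by move=> S T aST; apply/setP => k; rewrite -!(ha _).2 aST.
have [T hT] := inveig_small_norm psdM symM M1 a_inj (fun T => (ha T).1).
by exists (a T); first exact: (ha T).1.
Qed.

(** On the compact ball [sum_k x_k^2 <= n], minimize the squared residual of the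
    equations for [M].  A solution for [(1 - e) M + e] in that ball has residual
    [e^2] times a quantity bounded on the ball, so the minimum is 0. *)
Lemma inveig_small_norm_psd (R : realType) (n : nat) (M : 'M[R]_n) :
  M^T = M -> (forall k, M k k = 1) ->
  (forall x : 'rV[R]_n, 0 <= (x *m M *m x^T) 0 0) ->
  exists2 x : 'rV[R]_n, row_inveig M x & \sum_k x 0 k ^+ 2 <= n%:R.
Proof.
move=> symM M1 psdM.
pose ball := [set x : 'rV[R]_n | \sum_k x 0 k ^+ 2 <= n%:R]%classic.
have ball_compact : compact ball.
  have ball_closed : closed ball.
    by apply: (preimage_closed _ (@closed_le R n%:R)) => x _; exact: sqnorm_cont.
  pose box := [set x : 'rV[R]_n | forall k,
    `[- n%:R, n%:R]%classic (x ord0 k)]%classic.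
  have box_compact : compact box.
    by apply: (@rV_compact _ _ (fun=> `[_, _]%classic)) => _; exact: segment_compact.
  apply: subclosed_compact ball_closed box_compact _ => x /= xn k.
  rewrite set_itvE /= -ler_norml.
  have xk : x 0 k ^+ 2 <= n%:R.
    apply: le_trans xn; rewrite (bigD1 k) //= lerDl.
    by apply: sumr_ge0 => i _; rewrite sqr_ge0.
  have n1 : 1 <= n%:R :> R by rewrite ler1n (leq_trans _ (ltn_ord k)).
  by rewrite -ler_sqr ?nnegrE // -normrX ger0_norm ?sqr_ge0 //; nra.
have ball0 : (ball !=set0)%classic.
  exists 0; rewrite /ball /= big1 // => k _; by rewrite mxE expr0n.
(* If [x_k ((1 - e) x M + e x)_k = 1] then
   [x_k (x M)_k - 1 = e (x_k (x M)_k - x_k^2)]: hence the form of [err]. *)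
pose res (x : 'rV[R]_n) := \sum_k (x 0 k * (x *m M) 0 k - 1) ^+ 2.
pose err (x : 'rV[R]_n) := \sum_k (x 0 k * (x *m M) 0 k - x 0 k * x 0 k) ^+ 2.
have xy_cont k : continuous (fun x : 'rV[R]_n => x 0 k * (x *m M) 0 k).
  by apply: mul_cont; [exact: coord_cont|exact: mulmx_coord_cont].
have res_cont : continuous res.
  by apply: sum_cont => k; apply: mul_cont; apply: sub_cont => //; exact: cst_continuous.
have err_cont : continuous err.
  by apply: sum_cont => k; apply: mul_cont; apply: sub_cont => //;
    apply: mul_cont; exact: coord_cont.
have [x /set_mem xball xmin] := EVT_min_rV ball0 ball_compact (continuous_subspaceT res_cont).
have [z /set_mem zball zmax] := EVT_max_rV ball0 ball_compact (continuous_subspaceT err_cont).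
have res_le e : 0 < e -> e <= 1 -> res x <= e ^+ 2 * err z.
  move=> e0 e1.
  have [|||y yinv yball] := @inveig_small_norm_coercive R n ((1 - e) *: M + e%:M) e _ _ e0.
  - by rewrite linearD linearZ /= symM tr_scalar_mx.
  - by move=> k; rewrite !mxE M1 eqxx mulr1n; lra.
  - move=> y; rewrite mulmxDr mulmxDl -scalemxAr -scalemxAl mul_mx_scalar -scalemxAl.
    have -> : \sum_k y 0 k ^+ 2 = (y *m y^T) 0 0.
      by rewrite mxE; apply: eq_bigr => k _; rewrite mxE.
    by rewrite mx11_addE !mx11_scaleE lerDr mulr_ge0 ?subr_ge0.
  have {}yball : y \in ball by apply/mem_set.
  apply: le_trans (xmin y yball) _.
  apply: (@le_trans _ _ (e ^+ 2 * err y)); last first.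
    by rewrite ler_wpM2l ?sqr_ge0 // zmax.
  rewrite mulr_sumr le_eqVlt; apply/orP; left; apply/eqP/eq_bigr => k _.
  rewrite -exprMn; congr (_ ^+ 2).
  have yME : (y *m ((1 - e) *: M + e%:M)) 0 k = (1 - e) * (y *m M) 0 k + e * y 0 k.
    by rewrite mulmxDr -scalemxAr mul_mx_scalar [LHS]mxE; congr (_ + _); rewrite mxE.
  have := yinv k; rewrite yME => yk.
  by rewrite -[X in _ - X]yk; ring.
have err0 : 0 <= err z by apply: sumr_ge0 => k _; rewrite sqr_ge0.
have res0 : 0 <= res x by apply: sumr_ge0 => k _; rewrite sqr_ge0.
have res_eq0 : res x = 0.
  apply/eqP; rewrite eq_le res0 andbT leNgt; apply/negP => rgt0.
  (* Chosen so that [e <= 1] and [e^2 * err z < e * d = res x]. *)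
  pose d := 1 + err z + res x; pose e := res x / d.
  have d0 : 0 < d by rewrite /d; lra.
  have e0 : 0 < e by rewrite divr_gt0.
  have ed : e * d = res x by rewrite mulfVK ?gt_eqF.
  have e1 : e <= 1 by rewrite ler_pdivrMr // mul1r /d; lra.
  have := res_le e e0 e1; rewrite -ed leNgt => /negP; apply.
  rewrite expr2 -mulrA ltr_pM2l //; apply: (@le_lt_trans _ _ (err z)).
    by rewrite ler_piMl.
  by rewrite /d; lra.
exists x => // k.
have sq0 i : 0 <= (x 0 i * (x *m M) 0 i - 1) ^+ 2 by rewrite sqr_ge0.
have /eqP := @psumr_eq0P _ _ _ _ (fun i _ => sq0 i) res_eq0 k isT.
by rewrite sqrf_eq0 subr_eq0 => /eqP.
Qed.

Lemma norm_real_complex (R : realType) (u : R) :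
  `|real_complex R u| = real_complex R `|u|.
Proof. by rewrite normc_def /= expr0n addr0 sqrtr_sqr. Qed.

Theorem corollary2 (R : realType) (n : nat) (hn : (2 <= n)%N) (M : 'M[R]_n)
    (hM : correlation_matrix M) :
  exists alpha : 'cV[R[i]]_n,
    inverse_eigenvectors (map_mx (real_complex R) M) alpha /\
    `|coord_prod alpha| <= 1.
Proof.
have [[symM psdM] M1] := hM.
have [|x xinv xn] := inveig_small_norm_psd symM M1.
  by move=> x; have := psdM x^T; rewrite trmxK.
have n0 : 0 < n%:R :> R by rewrite ltr0n (leq_trans _ hn).
have prod_le1 : \prod_k `|x 0 k| <= 1.
  rewrite -(@ler_sqr R) ?nnegrE ?prodr_ge0 // expr1n -prodrXl.
  have := @leif_AGM R _ 'I_n (fun k => `|x 0 k| ^+ 2).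
  case=> [k _|+ _]; first by rewrite sqr_ge0.
  move=> /le_trans; apply; rewrite card_ord exprn_ile1 //.
    by rewrite divr_ge0 ?sumr_ge0 // => k _; rewrite sqr_ge0.
  rewrite ler_pdivrMr // mul1r; apply: le_trans xn.
  by under eq_bigr do rewrite -normrX ger0_norm ?sqr_ge0 //.
exists (map_mx (real_complex R) x^T); split=> [k|].
  have MxE : (M *m x^T) k 0 = (x *m M) 0 k by rewrite -{1}symM -trmx_mul mxE.
  rewrite -map_mxM [map_mx _ (M *m _) _ _]mxE MxE [map_mx _ _ _ _]mxE.
  by rewrite [x^T _ _]mxE -rmorphM /= xinv rmorph1.
rewrite /coord_prod; under eq_bigr do rewrite !mxE.
rewrite -rmorph_prod norm_real_complex normr_prod.
by move: prod_le1; rewrite -lecR.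
Qed.
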